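(* Let $n\ge 3$, let $G = D_{2n} = \langle x, y : x^n = y^2 = 1,\ yxy = x^{-1}\rangle$, and let $\mathcal{CCC}(G)$ be its commuting conjugacy class graph. Then: (1) The spectrum of $\mathcal{CCC}(G)$ is $$\mathrm{Spec}(\mathcal{CCC}(G)) = \begin{cases}\left\{(-1)^{\frac{n - 3}{2}}, 0^{1}, \left(\frac{n - 3}{2}\right)^{1}\right\}, & \text{if } n \text{ is odd},\\ \left\{(-1)^{\frac{n}{2} - 2}, 0^{2}, \left(\frac{n}{2} - 2\right)^{1}\right\}, & \text{if } n \text{ and } \frac{n}{2} \text{ are even},\\ \left\{(-1)^{\frac{n}{2} - 1}, 1^{1}, \left(\frac{n}{2} - 2\right)^{1}\right\}, & \text{if } n \text{ is even and } \frac{n}{2} \text{ is odd},\end{cases}$$ and $$E(\mathcal{CCC}(G)) = \begin{cases} n - 3, & \text{if } n \text{ is odd},\\ n - 4, & \text{if } n \text{ and } \frac{n}{2} \text{ are even},\\ n - 2, & \text{if } n \text{ is even and } \frac{n}{2} \text{ is odd}.\end{cases}$$ (2) The Laplacian spectrum is $$\mathrm{L\text{-}Spec}(\mathcal{CCC}(G)) = \begin{cases}\left\{0^{2}, \left(\frac{n - 1}{2}\right)^{\frac{n - 3}{2}}\right\}, & \text{if } n \text{ is odd},\\ \left\{0^{3}, \left(\frac{n}{2}- 1\right)^{\frac{n}{2} - 2}\right\}, & \text{if } n \text{ and } \frac{n}{2} \text{ are even},\\ \left\{0^{2}, 2^1, \left(\frac{n}{2}- 1\right)^{\frac{n}{2}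 - 2}\right\}, & \text{if } n \text{ is even and } \frac{n}{2} \text{ is odd},\end{cases}$$ and $$LE(\mathcal{CCC}(G)) = \begin{cases}\frac{2(n - 1)(n - 3)}{n + 1}, & \text{if } n \text{ is odd},\\ \frac{3(n - 2)(n - 4)}{n + 2}, & \text{if } n \text{ and } \frac{n}{2} \text{ are even},\\ 4, & \text{if } n = 6,\\ \frac{(n - 4)(3n - 10)}{n + 2}, & \text{if } n \text{ is even},\ n \geq 10 \text{ and } \frac{n}{2} \text{ is odd}.\end{cases}$$ (3) The signless Laplacian spectrum is $$\mathrm{Q\text{-}Spec}(\mathcal{CCC}(G)) = \begin{cases}\left\{0^{1}, (n - 3)^{1}, \left(\frac{n - 5}{2}\right)^{\frac{n - 3}{2}}\right\}, & \text{if } n \text{ is odd},\\ \left\{0^{2}, (n - 4)^{1}, \left(\frac{n}{2}- 3\right)^{\frac{n}{2} - 2}\right\}, & \text{if } n \text{ and } \frac{n}{2} \text{ are even},\\ \left\{2^1, 0^{1}, (n - 4)^{1}, \left(\frac{n}{2}- 3\right)^{\frac{n}{2} - 2}\right\}, & \text{if } n \text{ is even and } \frac{n}{2} \text{ is odd},\end{cases}$$ and $$LE^+(\mathcal{CCC}(G)) = \begin{cases}\frac{(n - 3)(n + 3)}{n + 1}, & \text{if } n \text{ is odd},\\ \frac{(n - 4)(n + 6)}{n + 2}, & \text{if } n = 4, 8,\\ \frac{2(n - 2)(n - 4)}{n + 2}, & \text{if } n, \frac{n}{2} \text{ are even and } n \geq 12,\\ 4, & \text{if } n = 6,\\ \frac{22}{3},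 & \text{if } n = 10,\\ \frac{2(n - 2)(n - 6)}{n + 2}, & \text{if } n \text{ is even},\ n \geq 14 \text{ and } \frac{n}{2} \text{ is odd}.\end{cases}$$
   Context: For a finite non-abelian group $G$, the commuting conjugacy class graph $\mathcal{CCC}(G)$ is the simple undirected graph whose vertices are the conjugacy classes of the non-central elements of $G$; two distinct vertices $x^G$ and $y^G$ are adjacent iff there exist $x'\in x^G$ and $y'\in y^G$ with $x'y'=y'x'$. For a finite graph $\mathcal{G}$ with adjacency matrix $A(\mathcal{G})$ and (diagonal) degree matrix $D(\mathcal{G})$, put $L(\mathcal{G})=D(\mathcal{G})-A(\mathcal{G})$ and $Q(\mathcal{G})=D(\mathcal{G})+A(\mathcal{G})$. $\mathrm{Spec}(\mathcal{G})$, $\mathrm{L\text{-}Spec}(\mathcal{G})$, $\mathrm{Q\text{-}Spec}(\mathcal{G})$ are the multisets of eigenvalues of $A(\mathcal{G})$, $L(\mathcal{G})$, $Q(\mathcal{G})$ respectively. In the notation $\{\alpha_1^{a_1},\dots,\alpha_l^{a_l}\}$ the exponent is a multiplicity; if listed values coincide their multiplicities are added, and exponent $0$ means the value is absent. With $d=\frac{2|e(\mathcal{G})|}{|V(\mathcal{G})|}$ ($|V(\mathcal{G})|$ the number of vertices, $|e(\mathcal{G})|$ the number of edges), the energy, Laplacian energy and signless Laplacian energy (sums with multiplicity) are $E(\mathcal{G})=\sum_{\lambda\in \mathrm{Spec}(\mathcal{G})}|\lambda|$, $LE(\mathcal{G})=\sum_{\mu\in \mathrm{L\text{-}Spec}(\mathcal{G})}|\mu-d|$,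 $LE^+(\mathcal{G})=\sum_{\nu\in \mathrm{Q\text{-}Spec}(\mathcal{G})}|\nu-d|$. *)

(* Defs.v *)
From mathcomp Require Import all_boot all_order all_algebra all_fingroup.
From mathcomp Require Import all_solvable.

Set Implicit Arguments.
Unset Strict Implicit.
Unset Printing Implicit Defensive.

Import Order.TTheory GRing.Theory Num.Theory.
Local Open Scope ring_scope.

Record sgraph := SGraph {
  vertex :> finType;
  adj : rel vertex;
  adj_sym : symmetric adj;
  adj_irrefl : irreflexive adj
}.

Definition edges (X : sgraph) : {set {set X}} :=
  [set [set p.1; p.2] | p in [pred p : X * X | adj p.1 p.2]].

Definition degree (X : sgraph) (u : X) : nat := #|[set v | adj u v]|.

(* The matrices have integer entries and are read in an algebraically closed
   field C with a norm (e.g. the complex numbers), so that the multiset of all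
   eigenvalues is available as the multiset of roots of the characteristic
   polynomial. Vertices are indexed by enum_val : 'I_#|X| -> X. *)
Section Spectra.
Variable C : numClosedFieldType.

Definition adjacency_mx (X : sgraph) : 'M[C]_#|X| :=
  \matrix_(i, j) (adj (enum_val i) (enum_val j))%:R.

Definition degree_mx (X : sgraph) : 'M[C]_#|X| :=
  diag_mx (\row_i (degree (enum_val i))%:R).

Definition laplacian_mx (X : sgraph) : 'M[C]_#|X| :=
  degree_mx X - adjacency_mx X.

Definition signless_laplacian_mx (X : sgraph) : 'M[C]_#|X| :=
  degree_mx X + adjacency_mx X.

(* Only meaningful up to perm_eq: the order of the eigenvalues is arbitrary. *)
Definition eigenvalues (n : nat) (A : 'M[C]_n) : seq C :=
  sval (closed_field_poly_normal (char_poly A)).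

Lemma eigenvaluesP (n : nat) (A : 'M[C]_n) :
  char_poly A = \prod_(a <- eigenvalues A) ('X - a%:P).
Proof.
rewrite /eigenvalues; case: closed_field_poly_normal => s /= {1}->.
by rewrite (monicP (char_poly_monic A)) scale1r.
Qed.

Definition Spec (X : sgraph) : seq C := eigenvalues (adjacency_mx X).
Definition LSpec (X : sgraph) : seq C := eigenvalues (laplacian_mx X).
Definition QSpec (X : sgraph) : seq C := eigenvalues (signless_laplacian_mx X).

Definition average_degree (X : sgraph) : C := 2 * #|edges X|%:R / #|X|%:R.

Definition energy (X : sgraph) : C := \sum_(a <- Spec X) `|a|.
Definition LE (X : sgraph) : C := \sum_(a <- LSpec X) `|a - average_degree X|.
Definition LEplus (X : sgraph) : C :=
  \sum_(a <- QSpec X) `|a - average_degree X|.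

End Spectra.

Section CommutingConjugacyClassGraph.
Variables (gT : finGroupType) (G : {group gT}).
Local Open Scope group_scope.

Definition noncentral_classes : {set {set gT}} :=
  [set x ^: G | x in G :\: 'Z(G)].

Definition ccc_vertex : finType := {K : {set gT} | K \in noncentral_classes}.

Definition ccc_adj : rel ccc_vertex := fun K L =>
  (K != L) && [exists x in val K, exists y in val L, x * y == y * x].

Lemma ccc_adj_sym : symmetric ccc_adj.
Proof.
suff sub K L : ccc_adj K L -> ccc_adj L K by move=> K L; apply/idP/idP; apply: sub.
case/andP=> neqKL /exists_inP[x Kx /exists_inP[y Ly cxy]].
rewrite /ccc_adj eq_sym neqKL; apply/exists_inP; exists y => //.
by apply/exists_inP; exists x => //; rewrite eq_sym.
Qed.

Lemma ccc_adj_irrefl : irreflexive ccc_adj.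
Proof. by move=> K; rewrite /ccc_adj eqxx. Qed.

Definition CCC : sgraph := SGraph ccc_adj_sym ccc_adj_irrefl.

End CommutingConjugacyClassGraph.

(* Main.v *)
Require Import Defs.
From mathcomp Require Import all_boot all_order all_algebra all_fingroup.
From mathcomp Require Import all_solvable.
From mathcomp Require Import ring zify.

Set Implicit Arguments.
Unset Strict Implicit.
Unset Printing Implicit Defensive.

Import Order.TTheory GRing.Theory Num.Theory.
Local Open Scope ring_scope.

(* CCC(D_2n) is a disjoint union of complete graphs. Write m = (n - 1) / 2,
   rounded down. The m noncentral rotation classes {x^i, x^-i} form a clique, and
   no noncentral rotation commutes with a reflection. For odd n all reflections
   are conjugate; for even n they form two classes, of y and of xy, and x^i y
   commutes with x^j y iff n divides 2(i - j), which can happen for i - j odd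
   only if n/2 is odd. So the graph is K_m + K_1, K_m + K_2 or K_m + 2 K_1.

   On a disjoint union of cliques with vertex classes c, each of the three
   matrices has the form M = D + U V, where D is diagonal with entries a(c(u)),
   U is b(c(u)) on the class of u and V is the incidence matrix of the classes.
   As D U = U D' for the diagonal matrix D' of the a(i), a Sylvester-type
   determinant identity reduces char_poly M to a product over the classes. *)

(** * Determinants and eigenvalues of matrices that depend only on classes *)

(** For invertible [D] and [D'] this is Sylvester's identity det(1 + AB) = det(1 + BA) with A = D^-1
    U = U D'^-1 and B = V. The block matrix argument inverts nothing, so it also applies over
    polynomial rings, where X - a is not a unit. *)
Lemma det_add_mul_intertwined (R : comNzRingType) (n k : nat) (D : 'M[R]_n)
    (D' : 'M[R]_k) (U : 'M[R]_(n, k)) (V : 'M[R]_(k, n)) :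
  D *m U = U *m D' -> \det (D + U *m V) * \det D' = \det D * \det (D' + V *m U).
Proof.
(* [B] is multiplied on the right by two block triangular matrices. The first clears the lower left
   block and leaves [D + U *m V]; the second clears the upper right block, by [DU], and leaves
   [D' + V *m U]. *)
move=> DU; pose B := block_mx D U (- V) 1%:M.
have detB : \det B = \det (D + U *m V).
  have := det_mulmx B (block_mx 1%:M 0 V 1%:M).
  rewrite mulmx_block !(mulmx1, mul1mx, mulmx0, mul0mx, addr0, add0r) addNr.
  by rewrite det_ublock det_lblock !det1 !mulr1.
have := det_mulmx B (block_mx 1%:M (- U) 0 D').
rewrite mulmx_block !(mulmx1, mul1mx, mulmx0, mul0mx, addr0, add0r).
rewrite mulmxN DU addNr mulNmx mulmxN opprK det_lblock det_ublock det1 mul1r.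
by rewrite detB addrC => ->; rewrite addrC.
Qed.

Section ClassMatrix.
Variables (C : numClosedFieldType) (n k : nat) (c : 'I_n -> 'I_k).
Variables (a b : 'I_k -> C) (M : 'M[C]_n).
Hypothesis ME : forall i j, M i j = a (c i) *+ (i == j) + b (c i) *+ (c i == c j).

Let p (i : 'I_k) := #|[set u | c u == i]|.

(** The factors X - a_i on the left come from \det D' and are not divided out; an empty class
    contributes X - a_i to both sides. *)
Lemma char_poly_class_mx :
  char_poly M * \prod_i ('X - (a i)%:P) =
  \prod_u ('X - (a (c u))%:P) * \prod_i ('X - (a i + b i *+ p i)%:P).
Proof.
pose D : 'M[{poly C}]_n := diag_mx (\row_u ('X - (a (c u))%:P)).
pose D' : 'M[{poly C}]_k := diag_mx (\row_i ('X - (a i)%:P)).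
pose U : 'M[{poly C}]_(n, k) := \matrix_(u, i) (- (b i)%:P *+ (c u == i)).
pose V : 'M[{poly C}]_(k, n) := \matrix_(i, u) ((c u == i)%:R).
have DU : D *m U = U *m D'.
  apply/matrixP => u i; rewrite mul_diag_mx mul_mx_diag !mxE mulrC.
  by case: eqP => [->|] //; rewrite !mulr0n !mul0r.
have := det_add_mul_intertwined V DU.
have -> : D + U *m V = char_poly_mx M.
  apply/matrixP => u v; rewrite !mxE ME (bigD1 (c u)) //= big1 => [|i ne_i].
    rewrite !mxE eqxx mulr1n addr0 [c v == _]eq_sym rmorphD /= !rmorphMn /=.
    by case: (u == v); case: (c u == c v); rewrite ?mulr1n ?mulr0n; ring.
  by rewrite !mxE eq_sym (negPf ne_i) mulr0n mul0r.
(* Distinct classes share no index, so [V *m U] is diagonal, with entry -b_i times the size of class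
   i. *)
have -> : D' + V *m U = diag_mx (\row_i ('X - (a i + b i *+ p i)%:P)).
  apply/matrixP => i j; rewrite !mxE.
  rewrite (eq_bigr (fun u => (- (b j)%:P) *+ ((c u == i) && (c u == j)))); last first.
    by move=> u _; rewrite !mxE; case: eqP; case: eqP; rewrite ?(mul1r, mul0r).
  have [->|ne_ij] := eqVneq i j.
    under eq_bigr do rewrite andbb.
    rewrite sumrMnr (_ : (\sum_u (c u == j))%N = p j); last first.
      by rewrite /p -sum1_card [RHS]big_mkcond; apply: eq_bigr => u _; rewrite inE; case: eqP.
    by rewrite mulr1n polyCD polyCMn mulNrn mulr1n opprD addrA.
  rewrite !mulr0n add0r big1 // => u _.
  by case: eqP => // ->; rewrite (negPf ne_ij).
have prodE m (F : 'I_m -> {poly C}) : \det (diag_mx (\row_i F i)) = \prod_i F i.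
  by rewrite det_diag; apply: eq_bigr => i _; rewrite mxE.
by rewrite !prodE.
Qed.

Lemma perm_eigenvalues_class_mx :
  perm_eq (eigenvalues M ++ [seq a i | i <- enum 'I_k])
    ([seq a (c u) | u <- enum 'I_n] ++ [seq a i + b i *+ p i | i <- enum 'I_k]).
Proof.
apply: prod_XsubC_eq; rewrite !big_cat /= !big_image -eigenvaluesP /=.
exact: char_poly_class_mx.
Qed.

(** One copy of a_i cancels for each nonempty class. The value a_i + b_i p_i belongs to the
    indicator vector of class i, and the p_i - 1 copies of a_i to the vectors supported on the class
    with sum zero. *)
Lemma eigenvalues_class_mx : (forall i, 0 < p i)%N ->
  perm_eq (eigenvalues M)
    (flatten [seq a i + b i *+ p i :: nseq (p i).-1 (a i) | i <- enum 'I_k]).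
Proof.
move=> p_gt0; apply/seq.permP => P; have /seq.permP/(_ P) := perm_eigenvalues_class_mx.
rewrite !count_cat count_flatten sumnE big_map big_image /=.
have countE (I : finType) (F : I -> C) :
    count P [seq F i | i <- enum I] = (\sum_i P (F i))%N.
  by rewrite -sum1_count big_image_cond big_mkcondr /=; apply: eq_bigr => i _; case: (P _).
rewrite !countE [in X in _ = X -> _](partition_big c xpredT) //=.
rewrite -big_split /= => E.
(* The cancelled copies are added back on both sides, so that multiplicities can be compared class
   by class. *)
apply: (@addIn (\sum_i P (a i))%N); rewrite E -big_split /=; apply: eq_bigr => i _.
rewrite (eq_bigr (fun=> (P (a i) : nat))); last by move=> u /eqP ->.
rewrite sum_nat_const -[X in (X * _)%N]cardsE -/(p i) count_nseq.
by rewrite -{1}(prednK (p_gt0 i)) mulSn; ring.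
Qed.
End ClassMatrix.

(** * Spectra of disjoint unions of complete graphs *)

(** Double counting of ordered adjacent pairs: the fibre over an edge {u, v} consists of (u, v) and
    (v, u), which differ because [adj] is irreflexive. *)
Lemma card_edges2 (X : sgraph) : (2 * #|edges X| = \sum_(u : X) degree u)%N.
Proof.
rewrite /degree; under eq_bigr do rewrite -sum1_card.
rewrite pair_big_dep /= -sum1_card.
rewrite [RHS](eq_bigl (mem [pred p : X * X | adj p.1 p.2])); last first.
  by move=> [u v]; rewrite !inE.
rewrite [RHS](partition_big_imset (fun p : X * X => [set p.1; p.2])) /= -/(edges X).
rewrite big_distrr /=; apply: eq_bigr => e /imsetP[[u v] /= uv ->]; rewrite !inE /= in uv.
have ne_uv : u != v by apply: contraTneq uv => ->; rewrite adj_irrefl.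
rewrite (eq_bigl (mem [set (u, v); (v, u)])) => [|[s t]]; last first.
  rewrite !inE /= !xpair_eqE; apply/andP/orP => [[st /eqP E]|].
    have : s \in [set u; v] by rewrite -E set21.
    rewrite !inE => /orP[]/eqP Es; subst s.
      have : v \in [set u; t] by rewrite E set22.
      by rewrite !inE [v == u]eq_sym (negPf ne_uv) => /eqP <-; left; rewrite !eqxx.
    have : u \in [set v; t] by rewrite E set21.
    by rewrite !inE (negPf ne_uv) => /eqP <-; right; rewrite !eqxx.
  by case=> /andP[/eqP-> /eqP->]; rewrite ?[adj v u]adj_sym uv // setUC.
by rewrite sum1_card cards2 xpair_eqE (negPf ne_uv).
Qed.

(* X is a disjoint union of complete graphs of orders s, and c maps a vertex to
   the index in s of its component; a zero in s stands for an absent component. *)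
Definition disjoint_cliques (X : sgraph) (s : seq nat) :=
  exists c : X -> 'I_(size s),
    (forall u v, adj u v = (u != v) && (c u == c v)) /\
    (forall i, #|[set u | c u == i]| = nth 0%N s i).

Section DisjointCliques.
Variables (C : numClosedFieldType) (X : sgraph) (s : seq nat).
Hypothesis Xs : disjoint_cliques X s.

Lemma card_disjoint_cliques : #|X| = sumn s.
Proof.
case: Xs => c [_ cs]; rewrite sumnE (big_nth 0%N) big_mkord -sum1_card.
rewrite (partition_big c xpredT) //=; apply: eq_bigr => i _.
by rewrite -cs -sum1_card; apply: eq_bigl => u; rewrite inE.
Qed.

Lemma degree_disjoint_cliques (c : X -> 'I_(size s)) (u : X) :
    (forall u v, adj u v = (u != v) && (c u == c v)) ->
    (forall i, #|[set u | c u == i]| = nth 0%N s i) ->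
  degree u = (nth 0%N s (c u)).-1.
Proof.
move=> adjE cs; rewrite -cs (cardsD1 u) inE eqxx add1n; apply: eq_card => v.
by rewrite !inE adjE eq_sym [c v == _]eq_sym.
Qed.

Lemma card_edges_disjoint_cliques :
  (2 * #|edges X| = \sum_(q <- s) q * q.-1)%N.
Proof.
case: (Xs) => c [adjE cs]; rewrite card_edges2 (big_nth 0%N) big_mkord.
rewrite (partition_big c xpredT) //=; apply: eq_bigr => i _.
rewrite -{1}cs -sum_nat_const big_set; apply: eq_bigr => u /eqP <-.
exact: degree_disjoint_cliques.
Qed.

Lemma average_degree_disjoint_cliques :
  average_degree C X = (\sum_(q <- s) q * q.-1)%:R / (sumn s)%:R.
Proof.
by rewrite /average_degree -natrM card_edges_disjoint_cliques card_disjoint_cliques.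
Qed.

(** In a clique of order q every degree is q - 1, so the argument of [f] and [g] is the clique
    order, and being equal or adjacent means lying in the same clique. The pair (f, g) is (-1, 1)
    for the adjacency matrix, (q, -1) for the Laplacian and (q - 2, 1) for the signless
    Laplacian. *)
Lemma eigenvalues_disjoint_cliques (f g : nat -> C) (M : 'M[C]_#|X|) :
    all (leq 1) s ->
    (forall i j, M i j =
       f (degree (enum_val i)).+1 *+ (i == j) +
       g (degree (enum_val i)).+1 *+
         ((i == j) || adj (enum_val i) (enum_val j))) ->
  perm_eq (eigenvalues M)
    (flatten [seq f q + g q *+ q :: nseq q.-1 (f q) | q <- s]).
Proof.
move=> /all_nthP s_gt0 ME; case: (Xs) => c [adjE cs].
have n_gt0 i : (0 < nth 0 s (i : 'I_(size s)))%N by apply: s_gt0.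
pose c' i := c (enum_val (i : 'I_#|X|)).
have cs' i : #|[set u | c' u == i]| = nth 0%N s i.
  rewrite -cs -(card_imset _ enum_val_inj); apply: eq_card => u.
  apply/imsetP/idP => [[j]|]; first by rewrite !inE => cj ->.
  by rewrite inE => cu; exists (enum_rank u); rewrite ?inE /c' enum_rankK.
have ME' i j : M i j = f (nth 0%N s (c' i)) *+ (i == j) +
    g (nth 0%N s (c' i)) *+ (c' i == c' j).
  rewrite ME (degree_disjoint_cliques _ adjE cs) prednK // adjE (inj_eq enum_val_inj).
  by rewrite /c'; case: eqP => // ->; rewrite eqxx.
pose a i := f (nth 0%N s (i : 'I_(size s))); pose b i := g (nth 0%N s (i : 'I_(size s))).
have := @eigenvalues_class_mx C _ _ c' a b M ME' _.
rewrite (eq_map (fun i => congr1 (fun q => a i + b i *+ q :: nseq q.-1 (a i)) (cs' i))).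
move=> H; rewrite -(mkseq_nth 0%N s) /mkseq -val_enum_ord -2!map_comp; apply: H => i.
by rewrite cs'.
Qed.

Lemma Spec_disjoint_cliques : all (leq 1) s ->
  perm_eq (Spec C X) (flatten [seq q.-1%:R :: nseq q.-1 (-1) | q <- s]).
Proof.
move=> s_gt0.
have := @eigenvalues_disjoint_cliques (fun=> -1) (fun=> 1) (adjacency_mx C X) s_gt0.
have -> : [seq q.-1%:R :: nseq q.-1 (-1) | q <- s] =
          [seq -1 + 1 *+ q :: nseq q.-1 (-1 : C) | q <- s].
  by apply/eq_in_map => q /(allP s_gt0); case: q => // q _; rewrite mulrS addKr.
apply=> i j; rewrite mxE; case: eqP => [->|_]; last by rewrite add0r.
by rewrite adj_irrefl addNr.
Qed.

Lemma LSpec_disjoint_cliques : all (leq 1) s ->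
  perm_eq (LSpec C X) (flatten [seq 0 :: nseq q.-1 q%:R | q <- s]).
Proof.
move=> s_gt0.
have := @eigenvalues_disjoint_cliques (fun q => q%:R) (fun=> -1) (laplacian_mx C X) s_gt0.
have -> : [seq 0 :: nseq q.-1 q%:R | q <- s] =
          [seq q%:R + -1 *+ q :: nseq q.-1 (q%:R : C) | q <- s].
  by apply: eq_map => q; rewrite mulNrn subrr.
apply=> i j; rewrite !mxE; case: eqP => [->|_]; last first.
  by rewrite !mulr0n !add0r mulNrn.
by rewrite adj_irrefl subr0 !mulr1n mulrS addrAC subrr add0r.
Qed.

Lemma QSpec_disjoint_cliques : all (leq 1) s ->
  perm_eq (QSpec C X)
    (flatten [seq 2 * q.-1%:R :: nseq q.-1 (q%:R - 2) | q <- s]).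
Proof.
move=> s_gt0.
have := @eigenvalues_disjoint_cliques (fun q => q%:R - 2) (fun=> 1)
  (signless_laplacian_mx C X) s_gt0.
have -> : [seq 2 * q.-1%:R :: nseq q.-1 (q%:R - 2) | q <- s] =
          [seq q%:R - 2 + 1 *+ q :: nseq q.-1 (q%:R - 2 : C) | q <- s].
  apply/eq_in_map => q /(allP s_gt0); case: q => // q _.
  by congr cons; rewrite /= mulrS; ring.
apply=> i j; rewrite !mxE; case: eqP => [->|_]; last by rewrite !mulr0n !add0r.
by rewrite adj_irrefl !mulr1n addr0 mulrS; ring.
Qed.
End DisjointCliques.

(** * Conjugacy and commutation in dihedral groups *)

Section Dihedral.
Local Open Scope group_scope.

(** The relations only bound orders from above: #[x] divides n and |G| <= 2 #[x]. The concrete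
    dihedral group satisfies the relations, hence is an image of [G], which gives 2n <= |G| and
    forces equality. *)
Lemma dihedral_generators (n : nat) (gT : finGroupType) (G : {group gT}) :
    (2 <= n)%N ->
    G \isog Grp (x : y : x ^+ n = 1, y ^+ 2 = 1, y * x * y = x^-1) ->
  exists x y, [/\ G :=: <[x]> :|: <[x]> :* y, #[x] = n, y \notin <[x]>,
    y ^+ 2 = 1 & {in <[x]>, forall a, a ^ y = a^-1}].
Proof.
move=> n_gt1 isoG.
have leG : (n.*2 <= #|G|)%N.
  rewrite -[n.*2](card_dihedral n_gt1) leq_homg // isoG.
  have := isoGrp_hom (Grp_dihedral n_gt1).
  case/existsP=> -[x y] /=; rewrite !xpair_eqE => /and4P[/eqP defD xn y2 /eqP xy].
  apply/existsP; exists (x, y); rewrite /= !xpair_eqE defD eqxx xn y2 /=.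
  have yV : y^-1 = y by apply/eqP; rewrite eq_invg_mul -expg2.
  by rewrite -{1}yV -mulgA -conjgE xy.
have := isoGrp_hom isoG.
case/existsP=> -[x y] /=; rewrite !xpair_eqE => /and4P[/eqP defG /eqP xn /eqP y2 /eqP yxy].
exists x, y.
have yV : y^-1 = y by apply/eqP; rewrite eq_invg_mul -expg2 y2.
have xy : x ^ y = x^-1 by rewrite conjgE yV mulgA.
have nxy : <[y]> \subset 'N(<[x]>) by rewrite norms_cycle xy groupV cycle_id.
have cycy : <[y]> = [set 1; y].
  apply/setP=> z; rewrite !inE; apply/cycleP/orP => [[i ->]|].
    rewrite -(odd_double_half i) expgD -mul2n expgM y2 expg1n mulg1.
    by case: (odd i); rewrite ?expg1 ?expg0 eqxx; [right | left].
  by case=> /eqP->; [exists 0%N | exists 1%N].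
have GE : G :=: <[x]> :|: <[x]> :* y.
  by rewrite -defG norm_joinEr //= cycy mulgU mulg1.
have xle : (#[x] <= n)%N by apply: dvdn_leq; rewrite ?order_dvdn ?xn // ltnW.
have cardG : (#|G| <= #[x] + #[x])%N.
  by rewrite GE (leq_trans (leq_card_setU _ _)) // card_rcoset -orderE.
have ox : #[x] = n.
  by apply/eqP; rewrite eqn_leq xle -leq_double -[X in (_ <= X)%N]addnn (leq_trans leG).
split=> //.
  (* If y were in <x>, then G = <x> would have order n < 2n. *)
  apply: contraTN leG => xy'; rewrite -ltnNge GE rcoset_id // setUid -orderE ox.
  by rewrite -addnn -[X in (X < _)%N]addn0 ltn_add2l ltnW.
move=> a /cycleP[i ->]; by rewrite conjXg xy expVgn.
Qed.

Variables (gT : finGroupType) (G : {group gT}) (x y : gT).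
Hypotheses (GE : G :=: <[x]> :|: <[x]> :* y) (x'y : y \notin <[x]>).
Hypotheses (y2 : y ^+ 2 = 1) (xy : {in <[x]>, forall a, a ^ y = a^-1}).

Let yV : y^-1 = y. Proof. by apply/eqP; rewrite eq_invg_mul -expg2 y2. Qed.

Lemma dihedral_cases g : g \in G ->
  g \in <[x]> \/ exists2 b, b \in <[x]> & g = b * y.
Proof. by rewrite GE inE => /orP[|/rcosetP]; [left | right]. Qed.

Lemma rot_sub a : a \in <[x]> -> a \in G.
Proof. by rewrite GE inE => ->. Qed.

Lemma refl_sub b : b \in <[x]> -> b * y \in G.
Proof. by move=> xb; rewrite GE inE mem_rcoset mulgK xb orbT. Qed.

Lemma refl_notin b : b \in <[x]> -> b * y \notin <[x]>.
Proof. by move=> xb; rewrite groupMl. Qed.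

Lemma rotC a b : a \in <[x]> -> b \in <[x]> -> a * b = b * a.
Proof. by move=> xa xb; apply: (centsP (cycle_abelian x)). Qed.

Lemma refl_rot a : a \in <[x]> -> y * a = a^-1 * y.
Proof. by move=> xa; rewrite -xy // conjgE yV mulgA -!mulgA -expg2 y2 mulg1. Qed.

(** Since y a = a^-1 y, the two products are a b y and b a^-1 y. *)
Lemma rot_commute_refl a b : a \in <[x]> -> b \in <[x]> ->
  (a * (b * y) == b * y * a) = (a ^+ 2 == 1).
Proof.
move=> xa xb; rewrite -[b * y * a]mulgA refl_rot // !mulgA (rotC xa xb).
by rewrite (inj_eq (mulIg _)) (inj_eq (mulgI _)) expg2 -eq_invg_mul eq_sym.
Qed.

(** The two products reduce to the rotations a b^-1 and b a^-1. *)
Lemma refl_commute_refl a b : a \in <[x]> -> b \in <[x]> ->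
  (a * y * (b * y) == b * y * (a * y)) = (a ^+ 2 == b ^+ 2).
Proof.
move=> xa xb; rewrite !mulgA -(mulgA a) -(mulgA b) !refl_rot //.
rewrite !mulgA !(inj_eq (mulIg _)) -(inj_eq (mulIg (b * a))) {2}(rotC xb xa).
by rewrite !mulgA !mulgKV !expg2.
Qed.

Lemma rot_classE a : a \in <[x]> -> a ^: G = [set a; a^-1].
Proof.
move=> xa; apply/setP=> z; rewrite !inE; apply/imsetP/orP.
  case=> g /dihedral_cases[xg|[b xb ->]] ->.
    by left; rewrite conjgE (rotC xa xg) mulKg.
  by right; rewrite conjgM [a ^ b]conjgE (rotC xa xb) mulKg xy.
case=> /eqP->; first by exists 1; rewrite ?conjg1.
by exists y; rewrite ?xy // -[y]mul1g refl_sub.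
Qed.

Lemma refl_conj_rot b c : b \in <[x]> -> c \in <[x]> ->
  (b * y) ^ c = b * c^-1 ^+ 2 * y.
Proof.
move=> xb xc; rewrite conjgE -[b * y * c]mulgA refl_rot // expg2 !mulgA.
by rewrite (rotC _ xb) ?groupV.
Qed.

(** Conjugating by a rotation multiplies b by a square, and every square in <x> arises this way;
    conjugating by a reflection yields nothing new. *)
Lemma refl_classP b z : b \in <[x]> ->
  reflect (exists2 a, a \in <[x]> & z = b * a ^+ 2 * y) (z \in (b * y) ^: G).
Proof.
move=> xb; apply: (iffP imsetP) => [[g Gg ->]|[a xa ->]]; last first.
  by exists a^-1; rewrite ?refl_conj_rot ?groupV ?invgK // rot_sub ?groupV.
case/dihedral_cases: Gg => [xg|[c xc ->]].
  by exists g^-1; rewrite ?groupV // refl_conj_rot.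
(* Conjugation by c y sends b y to b^-1 c^2 y = b (b^-1 c)^2 y. *)
exists (b^-1 * c); first by rewrite groupM ?groupV.
rewrite conjgM refl_conj_rot // conjMg xy ?groupM ?groupX ?groupV //.
rewrite [y ^ y]conjgE mulKg; congr (_ * _); rewrite expgMn; last first.
  by apply: rotC; rewrite ?groupV.
rewrite !expg2 !mulgA mulgV mul1g !invMg !invgK mulgA.
by rewrite (rotC (groupM xc xc)) ?groupV // mulgA.
Qed.

Lemma rot_central a : a \in <[x]> -> (a \in 'Z(G)) = (a ^+ 2 == 1).
Proof.
move=> xa; apply/idP/idP => [/centerP[_ /(_ y)]|a2].
  rewrite -[y]mul1g refl_sub // => /(_ isT) /eqP.
  by rewrite rot_commute_refl.
apply/centerP; split=> [|g]; first exact: rot_sub.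
case/dihedral_cases=> [xg|[b xb ->]]; first exact: rotC.
by apply/eqP; rewrite rot_commute_refl.
Qed.

Hypothesis ox_gt2 : (2 < #[x])%N.

Lemma refl_noncentral b : b \in <[x]> -> b * y \notin 'Z(G).
Proof.
move=> xb; apply/negP=> /centerP[_ /(_ x (rot_sub (cycle_id x)))] /eqP.
rewrite eq_sym rot_commute_refl ?cycle_id // -order_dvdn => /dvdn_leq -/(_ isT).
by rewrite leqNgt ox_gt2.
Qed.

(** * Counting the noncentral rotation and reflection classes *)

Lemma noncentral_class_cases K : K \in noncentral_classes G ->
  (exists2 a, a \in <[x]> & [/\ a ^+ 2 != 1, K = a ^: G & K \subset <[x]>]) \/
  (exists2 b, b \in <[x]> & K = (b * y) ^: G /\ ~~ (K \subset <[x]>)).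
Proof.
case/imsetP=> g /setDP[/dihedral_cases[xg|[b xb ->]] Zg] ->.
  left; exists g => //; split=> //; first by rewrite -rot_central.
  by rewrite rot_classE // subUset !sub1set groupV xg.
right; exists b => //; split=> //.
by apply: contra (refl_notin xb) => /subsetP; apply; apply: class_refl.
Qed.

Lemma refl_class_noncentral b : b \in <[x]> ->
  (b * y) ^: G \in [set K in noncentral_classes G | ~~ (K \subset <[x]>)].
Proof.
move=> xb; rewrite inE; apply/andP; split.
  by apply: imset_f; rewrite inE refl_noncentral ?refl_sub.
by apply: contra (refl_notin xb) => /subsetP; apply; apply: class_refl.
Qed.

(** The representatives are x^1, ..., x^m: x^i and x^(n - i) are conjugate, and the exponents 0 and,
    for even n, n/2 give central elements. *)
Lemma card_rot_classes :
  #|[set K in noncentral_classes G | K \subset <[x]>]| = (#[x].-1)./2.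
Proof.
set m := (_./2); have m_lt : (m.*2 < #[x])%N by rewrite /m; lia.
have -> : [set K in noncentral_classes G | K \subset <[x]>] =
    [set x ^+ i.+1 ^: G | i : 'I_m].
  apply/setP=> K; rewrite inE; apply/andP/imsetP=> [[]|[i _ ->]].
    case/noncentral_class_cases=> [[a /cyclePmin[i i_lt ->]]|[b _ [_ /negPf->//]]].
    rewrite -expgM -order_dvdn => -[ni -> _ _].
    have i_gt0 : (0 < i)%N by case: i ni {i_lt}; rewrite ?dvdn0.
    (* This excludes i = n/2, so an exponent beyond m can be reflected to n - i <= m. *)
    have ne_i : (i * 2 != #[x])%N by apply: contraNneq ni => ->.
    have [i_le|i_gt] := leqP i m.
      have i_lt' : (i.-1 < m)%N by lia.
      by exists (Ordinal i_lt'); rewrite //= prednK.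
    have j_lt : ((#[x] - i).-1 < m)%N by rewrite /m in m_lt i_gt *; lia.
    exists (Ordinal j_lt) => //=; rewrite prednK; last by lia.
    have <- : (x ^+ i)^-1 = x ^+ (#[x] - i).
      by apply/eqP; rewrite eq_invg_mul -expgD subnKC ?expg_order // ltnW.
    by rewrite !rot_classE ?groupV ?mem_cycle // invgK setUC.
  have xi := mem_cycle x i.+1; have i_lt := ltn_ord i; split.
    apply: imset_f; rewrite inE rot_sub // rot_central // andbT -expgM -order_dvdn.
    by apply/negP=> /dvdn_leq; lia.
  by rewrite rot_classE // subUset !sub1set groupV xi.
rewrite card_imset ?card_ord // => i j /setP/(_ (x ^+ i.+1)).
have := ltn_ord i; have := ltn_ord j => j_lt i_lt.
rewrite !rot_classE ?mem_cycle // !inE eqxx => /esym/orP[|].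
  rewrite eq_expg_mod_order !modn_small; [|lia|lia].
  by move/eqP=> [/val_inj].
(* Here x^(i+1) is the inverse of x^(j+1), so n divides i + j + 2, which lies between 2 and 2m <
   n. *)
rewrite eq_mulgV1 invgK -expgD -order_dvdn => /dvdn_leq; lia.
Qed.

Lemma card_ccc_pred (P : pred {set gT}) :
  #|[set u : CCC G | P (val u)]| = #|[set K in noncentral_classes G | P K]|.
Proof.
rewrite -(card_imset _ val_inj); apply: eq_card => K.
apply/imsetP/idP => [[u]|]; first by rewrite !inE => Pu ->; rewrite (valP u) Pu.
by rewrite !inE => /andP[GK PK]; exists (exist _ K GK) => //; rewrite inE.
Qed.

Lemma refl_class_rot b c : b \in <[x]> -> c \in <[x]> ->
  (b * y) ^: G = (b * c ^+ 2 * y) ^: G.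
Proof.
by move=> xb xc; apply/esym/class_eqP/refl_classP => //; exists c.
Qed.

Lemma refl_classes_odd : odd #[x] ->
  [set K in noncentral_classes G | ~~ (K \subset <[x]>)] = [set y ^: G].
Proof.
move=> odd_n; apply/eqP; have := refl_class_noncentral (group1 <[x]>).
rewrite mul1g eqEsubset sub1set => ->; rewrite andbT.
apply/subsetP => K; rewrite !inE => /andP[/noncentral_class_cases[[a _ [_ _ ->]]//|]].
(* As b^n = 1 with n odd, b is the square of b^((n+1)/2), so b y is conjugate to y. *)
case=> b xb [-> _] _; have -> : b = 1 * (b ^+ (#[x].+1)./2) ^+ 2.
  have E : (#[x].+1./2 * 2 = #[x].+1)%N by lia.
  rewrite mul1g -expgM E expgS.
  by have /cycleP[i ->] := xb; rewrite -!expgM [(i * #[x])%N]mulnC expgM expg_order expg1n mulg1.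
by rewrite -refl_class_rot ?groupX // mul1g.
Qed.

Lemma refl_classes_even : ~~ odd #[x] ->
  [set K in noncentral_classes G | ~~ (K \subset <[x]>)] = [set y ^: G; (x * y) ^: G].
Proof.
move=> even_n; apply/eqP; have := refl_class_noncentral (group1 <[x]>).
rewrite mul1g eqEsubset subUset !sub1set => ->.
rewrite refl_class_noncentral ?cycle_id // !andbT.
apply/subsetP => K; rewrite !inE => /andP[/noncentral_class_cases[[a _ [_ _ ->]]//|]].
case=> _ /cycleP[i ->] [-> _] _.
(* Up to a square, x^i is 1 or x according to the parity of i. *)
rewrite -(odd_double_half i) expgD -muln2 expgM -refl_class_rot ?mem_cycle //.
by case: (odd i); rewrite ?expg1 ?expg0 ?mul1g eqxx ?orbT.
Qed.

(** For even n the parity of an exponent of x is well defined; this invariant separates the classes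
    of y and x y. *)
Lemma expg_even_double i j : ~~ odd #[x] -> x ^+ i = x ^+ j -> odd i = odd j.
Proof.
move=> even_n /eqP; rewrite eq_expg_mod_order => /eqP E.
have odd_mod l : odd (l %% #[x]) = odd l.
  by rewrite [in RHS](divn_eq l #[x]) oddD oddM (negPf even_n) andbF.
by rewrite -odd_mod E odd_mod.
Qed.

Lemma refl_classes_neq : ~~ odd #[x] -> y ^: G != (x * y) ^: G.
Proof.
move=> even_n; apply/eqP=> E; have := class_refl G (x * y).
rewrite -E -{2}[y]mul1g => /refl_classP[//|_ /cycleP[i ->]].
rewrite mul1g => /mulIg; rewrite -expgM -[x in LHS]expg1 => /(expg_even_double even_n).
by rewrite oddM andbF.
Qed.

Lemma rot_refl_class_commute a b g h : a \in <[x]> -> a ^+ 2 != 1 -> b \in <[x]> ->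
  g \in a ^: G -> h \in (b * y) ^: G -> g * h != h * g.
Proof.
move=> xa a2 xb; rewrite rot_classE // => ga /refl_classP[//|c xc ->].
have xg : g \in <[x]> by move: ga; rewrite !inE => /orP[]/eqP->; rewrite ?groupV.
rewrite rot_commute_refl ?groupM ?groupX //.
move: ga; rewrite !inE => /orP[]/eqP-> //.
by rewrite expVgn -eq_invg1 invgK.
Qed.

(** * The clique decomposition of the graph *)

Definition commuting_sets (K L : {set gT}) :=
  [exists g in K, exists h in L, g * h == h * g].

Lemma ccc_adjE (u v : CCC G) :
  adj u v = (u != v) &&
    (if val u \subset <[x]> then val v \subset <[x]>
     else ~~ (val v \subset <[x]>) && commuting_sets (val u) (val v)).
Proof.
rewrite /= /ccc_adj -/(commuting_sets _ _); congr (_ && _).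
have [[a xa [a2 Ku uX]]|[b xb [Ku /negPf uX]]] := noncentral_class_cases (valP u);
have [[c xc [c2 Kv vX]]|[c xc [Kv /negPf vX]]] := noncentral_class_cases (valP v);
rewrite uX vX Ku Kv //.
- apply/exists_inP; exists a; first exact: class_refl.
  by apply/exists_inP; exists c; rewrite ?class_refl // rotC.
- apply/negbTE/exists_inP => -[g gu /exists_inP[h hv]]; apply/negP.
  exact: rot_refl_class_commute gu hv.
- apply/negbTE/exists_inP => -[g gu /exists_inP[h hv]]; rewrite eq_sym; apply/negP.
  exact: rot_refl_class_commute hv gu.
- by rewrite -Ku -Kv.
Qed.

(** Covers odd n, with r = 1, and even n with n/2 odd, with r = 2. *)
Lemma disjoint_cliques_refl_commute r :
    #|[set K in noncentral_classes G | ~~ (K \subset <[x]>)]| = r ->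
    {in [set K in noncentral_classes G | ~~ (K \subset <[x]>)] &,
      forall K L, K != L -> commuting_sets K L} ->
  disjoint_cliques (CCC G) [:: (#[x].-1)./2; r].
Proof.
move=> card_refl refl_comm.
exists (fun u : CCC G => (if val u \subset <[x]> then ord0 else ord_max) : 'I_2); split.
  move=> u v; rewrite ccc_adjE; have [//|/= ne_uv] := eqVneq u v.
  case: ifPn => uX; case: ifPn => vX //=.
  by apply: refl_comm; rewrite ?inE ?(valP u) ?(valP v).
move=> i; transitivity #|[set K in noncentral_classes G | (K \subset <[x]>) == (i == ord0)]|.
  rewrite -(card_ccc_pred (fun K => (K \subset <[x]>) == (i == ord0))).
  by apply: eq_card => u; rewrite !inE; case: ifP => _; case: i => -[|[|]].
case: i => -[|[|//]] lt_i; [rewrite -[RHS]card_rot_classes|rewrite -[RHS]card_refl];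
  by apply: eq_card => K; rewrite !inE; case: (K \subset _).
Qed.

Lemma commuting_sets_sym K L : commuting_sets K L = commuting_sets L K.
Proof.
by apply/exists_inP/exists_inP => -[g Kg /exists_inP[h Lh cgh]];
  exists h => //; apply/exists_inP; exists g; rewrite // eq_sym.
Qed.

Lemma disjoint_cliques_refl_noncommute : ~~ odd #[x] ->
    ~~ commuting_sets (y ^: G) ((x * y) ^: G) ->
  disjoint_cliques (CCC G) [:: (#[x].-1)./2; 1%N; 1%N].
Proof.
move=> even_n noncomm; have neq_cl := refl_classes_neq even_n.
have refl_in K : (K \in noncentral_classes G) && ~~ (K \subset <[x]>) =
    (K == y ^: G) || (K == (x * y) ^: G).
  by have /setP/(_ K) := refl_classes_even even_n; rewrite !inE.
(* Component 0 holds the rotation classes, component 1 the class of y, and the last one the class of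
   x y, the only other reflection class by [refl_in]. *)
pose c (K : {set gT}) : 'I_3 := if K \subset <[x]> then ord0 else
                  if K == y ^: G then Ordinal (isT : 1 < 3)%N else ord_max.
exists (fun u : CCC G => c (val u)); split.
  move=> u v; rewrite ccc_adjE; have [//|/= ne_uv] := eqVneq u v; rewrite /c.
  have [uX|uX] := boolP (val u \subset _); have [vX|vX] := boolP (val v \subset _) => //=;
    try by case: ifP.
  have refl_cl (w : CCC G) : ~~ (val w \subset <[x]>) ->
      val w = y ^: G \/ val w = (x * y) ^: G.
    by move=> wX; have := refl_in (val w); rewrite (valP w) wX => /esym/orP[]/eqP; [left|right].
  move: ne_uv; rewrite -(inj_eq val_inj) /=.
  have [] := refl_cl u uX => ->; have [] := refl_cl v vX => ->.
  - by rewrite eqxx.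
  - by rewrite eqxx [_ == y ^: G]eq_sym (negPf neq_cl) => _; apply: negbTE.
  - by rewrite eqxx [_ == y ^: G]eq_sym (negPf neq_cl) commuting_sets_sym => _; apply: negbTE.
  - by rewrite eqxx.
move=> i; rewrite (card_ccc_pred (fun K => c K == i)).
case: i => -[|[|[|//]]] lt_i /=.
- rewrite -card_rot_classes; apply: eq_card => K; rewrite !inE /c; congr (_ && _).
  by case: ifP => // _; case: ifP.
- transitivity #|[set y ^: G]|; last by rewrite cards1.
   apply: eq_card => K; rewrite !inE /c.
  have := refl_in K; case: (K \subset <[x]>) => /=.
    by rewrite !andbF => /esym/norP[/negPf->].
  by rewrite andbT => ->; case: eqP => //= _; rewrite andbF.
- transitivity #|[set (x * y) ^: G]|; last by rewrite cards1.
   apply: eq_card => K; rewrite !inE /c.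
  have := refl_in K; case: (K \subset <[x]>) => /=.
    by rewrite !andbF => /esym/norP[_ /negPf->].
  rewrite andbT => ->; case: eqP => [->|_] /=; last by rewrite andbT.
  by rewrite (negPf neq_cl).
Qed.

(** Members x^(2i) y and x^(2j+1) y commute iff 4i and 4j + 2 agree modulo n. This is impossible
    when 4 divides n; when n/2 is odd, y and x^(n/2) y commute. *)
Lemma commuting_refl_classes : ~~ odd #[x] ->
  commuting_sets (y ^: G) ((x * y) ^: G) = odd #[x]./2.
Proof.
move=> even_n; apply/exists_inP/idP => [[g gy /exists_inP[h hxy]]|odd_n2].
  move: gy; rewrite -{1}[y]mul1g => /refl_classP[//|a /cycleP[i ->] ->].
  case/refl_classP: hxy => [|b /cycleP[j ->] ->]; rewrite ?cycle_id //.
  rewrite refl_commute_refl ?groupM ?groupX ?cycle_id // mul1g -!expgM -expgS -expgM.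
  rewrite eq_expg_mod_order => /eqP E; apply: contraT => even_n2.
  have n4 : (4 %| #[x])%N by lia.
  by have := congr1 (modn^~ 4) E; rewrite !(modn_dvdm _ n4); lia.
exists y; first exact: class_refl.
apply/exists_inP; exists (x ^+ #[x]./2 * y).
  apply/refl_classP; first exact: cycle_id.
  (* As n/2 is odd, x^(n/2) is x times the square of this power. *)
  exists (x ^+ #[x]./2./2); first exact: mem_cycle.
  by rewrite -expgM -expgS; congr (x ^+ _ * y); lia.
have := refl_commute_refl (group1 <[x]>) (mem_cycle x #[x]./2).
rewrite mul1g => ->; rewrite expg1n -expgM.
by rewrite (_ : (_ * 2 = #[x])%N) ?expg_order //; lia.
Qed.

Lemma disjoint_cliques_dihedral : disjoint_cliques (CCC G)
  ((#[x].-1)./2 ::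
    (if odd #[x] then [:: 1] else if odd #[x]./2 then [:: 2] else [:: 1; 1])%N).
Proof.
case: ifPn => [odd_n|even_n].
  apply: disjoint_cliques_refl_commute; rewrite refl_classes_odd ?cards1 //.
  by move=> K L /set1P-> /set1P->; rewrite eqxx.
have := commuting_refl_classes even_n; case: ifPn => _ comm; last first.
  by apply: disjoint_cliques_refl_noncommute; rewrite ?comm.
apply: disjoint_cliques_refl_commute; rewrite refl_classes_even //.
  by rewrite cards2 refl_classes_neq.
by move=> K L /set2P[]-> /set2P[]->; rewrite ?eqxx // => _; rewrite 1?commuting_sets_sym.
Qed.

End Dihedral.

Lemma ccc_dihedral_cliques (n : nat) (gT : finGroupType) (G : {group gT}) :
    (3 <= n)%N ->
    (G \isog Grp (x : y : x ^+ n = 1, y ^+ 2 = 1, y * x * y = x^-1))%g ->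
  disjoint_cliques (CCC G)
    (n.-1./2 :: (if odd n then [:: 1] else if odd n./2 then [:: 2] else [:: 1; 1])%N).
Proof.
move=> n_gt2 /(dihedral_generators (ltnW n_gt2))[x [y [GE ox x'y y2 xy]]].
by rewrite -ox; apply: (disjoint_cliques_dihedral GE x'y y2 xy); rewrite ox.
Qed.

(** * Energies of disjoint unions of complete graphs *)

Section Energies.
Variables (C : numClosedFieldType) (X : sgraph) (s : seq nat).
Hypotheses (Xs : disjoint_cliques X s) (s_gt0 : all (leq 1) s).

Lemma big_flatten_cons_nseq (F : C -> C) (u v : nat -> C) :
  \sum_(a <- flatten [seq u q :: nseq q.-1 (v q) | q <- s]) F a =
  \sum_(q <- s) (F (u q) + F (v q) *+ q.-1).
Proof.
rewrite big_flatten big_map; apply: eq_bigr => q _.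
by rewrite big_cons big_nseq iter_addr_0.
Qed.

Lemma energy_disjoint_cliques : energy C X = \sum_(q <- s) 2 * q.-1%:R.
Proof.
rewrite /energy (perm_big _ (Spec_disjoint_cliques C Xs s_gt0)) big_flatten_cons_nseq.
by apply: eq_bigr => q _; rewrite normr_nat normrN1; ring.
Qed.

Lemma LE_disjoint_cliques : let d := average_degree C X in
  LE C X = \sum_(q <- s) (`|0 - d| + `|q%:R - d| *+ q.-1).
Proof.
by rewrite /LE (perm_big _ (LSpec_disjoint_cliques C Xs s_gt0)) big_flatten_cons_nseq.
Qed.

Lemma LEplus_disjoint_cliques : let d := average_degree C X in
  LEplus C X = \sum_(q <- s) (`|2 * q.-1%:R - d| + `|q%:R - 2 - d| *+ q.-1).
Proof.
by rewrite /LEplus (perm_big _ (QSpec_disjoint_cliques C Xs s_gt0)) big_flatten_cons_nseq.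
Qed.
End Energies.

(** Evaluates an absolute value once the sign is known: the caller supplies a quotient of naturals
    and picks the sign with [left] or [right]. *)
Lemma norm_natf (C : numClosedFieldType) (z : C) (a b : nat) :
  z = a%:R / b%:R \/ z = - (a%:R / b%:R) -> `|z| = a%:R / b%:R.
Proof.
have ge0 : 0 <= a%:R / b%:R :> C by rewrite divr_ge0 ?ler0n.
by case=> ->; rewrite ?normrN ger0_norm.
Qed.

(** * A clique and one isolated vertex: n = 2k + 3 *)

Section CliqueAndPoint.
Variables (C : numClosedFieldType) (X : sgraph) (k : nat).
Let K : C := k%:R.
Hypothesis Xs : disjoint_cliques X [:: k.+1; 1]%N.

Let K2 : K + 2 != 0. Proof. by rewrite -natrD pnatr_eq0 addn2. Qed.

Let dE : average_degree C X = (K + 1) * K / (K + 2).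
Proof.
rewrite (average_degree_disjoint_cliques C Xs) !big_cons big_nil /=.
by rewrite !(addn0, muln0) natrM !natrD -natr1 -/K; congr (_ / _); ring.
Qed.

Lemma Spec_clique_1 : perm_eq (Spec C X) (tally_seq [:: (-1, k); (0, 1%N); (K, 1%N)]).
Proof.
apply: perm_trans (Spec_disjoint_cliques C Xs isT) _; apply/seq.permP => P.
by rewrite /= ?count_cat /= ?count_cat /= ?count_nseq; ring.
Qed.

Lemma LSpec_clique_1 : perm_eq (LSpec C X) (tally_seq [:: (0, 2%N); (K + 1, k)]).
Proof.
apply: perm_trans (LSpec_disjoint_cliques C Xs isT) _; apply/seq.permP => P.
by rewrite /= ?count_cat /= ?count_nseq -natr1 -/K /=; ring.
Qed.

Lemma QSpec_clique_1 :
  perm_eq (QSpec C X) (tally_seq [:: (0, 1%N); (2 * K, 1%N); (K - 1, k)]).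
Proof.
apply: perm_trans (QSpec_disjoint_cliques C Xs isT) _; apply/seq.permP => P.
have -> : K - 1 = k.+1%:R - 2 by rewrite -natr1 -/K; ring.
by rewrite /= ?count_cat /= ?count_nseq mulr0 -/K /=; ring.
Qed.

Lemma energy_clique_1 : energy C X = 2 * K.
Proof.
by rewrite (energy_disjoint_cliques C Xs isT) !big_cons big_nil /= mulr0 !addr0.
Qed.

Lemma LE_clique_1 : LE C X = 4 * K * (K + 1) / (K + 2).
Proof.
rewrite (LE_disjoint_cliques C Xs isT) !big_cons big_nil dE /= mulr0n !addr0.
rewrite (@norm_natf _ _ ((k + 1) * k) (k + 2)); last first.
  by right; rewrite natrM !natrD -/K; field.
rewrite (@norm_natf _ _ (2 * (k + 1)) (k + 2)); last first.
  by left; rewrite -natr1 natrM !natrD -/K; field.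
by rewrite -mulr_natr !natrM !natrD -/K; field.
Qed.

Lemma LEplus_clique_1 : LEplus C X = 2 * K * (K + 3) / (K + 2).
Proof.
rewrite (LEplus_disjoint_cliques C Xs isT) !big_cons big_nil dE /= mulr0n !addr0.
rewrite (@norm_natf _ _ (k * (k + 3)) (k + 2)); last first.
  by left; rewrite natrM !natrD -/K; field.
rewrite (@norm_natf _ _ 2 (k + 2)); last first.
  by right; rewrite -natr1 !natrD -/K; field.
rewrite (@norm_natf _ _ ((k + 1) * k) (k + 2)); last first.
  by right; rewrite natrM !natrD -/K; field.
by rewrite -mulr_natr !natrM !natrD -/K; field.
Qed.
End CliqueAndPoint.

(** * A clique and two isolated vertices: n = 2k + 4 with n/2 even *)

Section CliqueAndTwoPoints.
Variables (C : numClosedFieldType) (X : sgraph) (k : nat).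
Let K : C := k%:R.
Hypothesis Xs : disjoint_cliques X [:: k.+1; 1; 1]%N.

Let K3 : K + 3 != 0. Proof. by rewrite -natrD pnatr_eq0 addn3. Qed.

Let dE : average_degree C X = (K + 1) * K / (K + 3).
Proof.
rewrite (average_degree_disjoint_cliques C Xs) !big_cons big_nil /=.
by rewrite !(addn0, muln0) natrM !natrD -natr1 -/K; congr (_ / _); ring.
Qed.

Lemma Spec_clique_1_1 : perm_eq (Spec C X) (tally_seq [:: (-1, k); (0, 2%N); (K, 1%N)]).
Proof.
apply: perm_trans (Spec_disjoint_cliques C Xs isT) _; apply/seq.permP => P.
by rewrite /= ?count_cat /= ?count_cat /= ?count_nseq; ring.
Qed.

Lemma LSpec_clique_1_1 : perm_eq (LSpec C X) (tally_seq [:: (0, 3%N); (K + 1, k)]).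
Proof.
apply: perm_trans (LSpec_disjoint_cliques C Xs isT) _; apply/seq.permP => P.
by rewrite /= ?count_cat /= ?count_nseq -natr1 -/K /=; ring.
Qed.

Lemma QSpec_clique_1_1 :
  perm_eq (QSpec C X) (tally_seq [:: (0, 2%N); (2 * K, 1%N); (K - 1, k)]).
Proof.
apply: perm_trans (QSpec_disjoint_cliques C Xs isT) _; apply/seq.permP => P.
have -> : K - 1 = k.+1%:R - 2 by rewrite -natr1 -/K; ring.
by rewrite /= ?count_cat /= ?count_nseq mulr0 -/K /=; ring.
Qed.

Lemma energy_clique_1_1 : energy C X = 2 * K.
Proof.
by rewrite (energy_disjoint_cliques C Xs isT) !big_cons big_nil /= !mulr0 !addr0.
Qed.

Lemma LE_clique_1_1 : LE C X = 6 * K * (K + 1) / (K + 3).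
Proof.
rewrite (LE_disjoint_cliques C Xs isT) !big_cons big_nil dE /= !mulr0n !addr0.
rewrite (@norm_natf _ _ ((k + 1) * k) (k + 3)); last first.
  by right; rewrite natrM !natrD -/K; field.
rewrite (@norm_natf _ _ (3 * (k + 1)) (k + 3)); last first.
  by left; rewrite -natr1 natrM !natrD -/K; field.
by rewrite -mulr_natr !natrM !natrD -/K; field.
Qed.

(** The deviation (K - 3) / (K + 3) of the eigenvalue K - 1 is the only one whose sign depends on k,
    so its absolute value is kept. The two evaluations below agree at k = 3. *)
Let LEplusE : LEplus C X =
  K * (K + 5) / (K + 3) + `|(K - 3) / (K + 3)| * K + 2 * ((K + 1) * K / (K + 3)).
Proof.
rewrite (LEplus_disjoint_cliques C Xs isT) !big_cons big_nil dE /= !mulr0n !addr0.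
rewrite (@norm_natf _ _ (k * (k + 5)) (k + 3)); last first.
  by left; rewrite natrM !natrD -/K; field.
rewrite (@norm_natf _ (2 * 0 - _) ((k + 1) * k) (k + 3)); last first.
  by right; rewrite natrM !natrD -/K; field.
rewrite -mulr_natr !natrM !natrD -/K.
rewrite (_ : k.+1%:R - 2 - _ = (K - 3) / (K + 3)); first by field.
by rewrite -natr1 -/K; field.
Qed.

Lemma LEplus_clique_1_1_small : (k <= 3)%N -> LEplus C X = 2 * K * (K + 5) / (K + 3).
Proof.
move=> k_le; rewrite LEplusE (@norm_natf _ _ (3 - k) (k + 3)); last first.
  by right; rewrite natrB // natrD -/K; field.
by rewrite natrB // natrD -/K; field.
Qed.

Lemma LEplus_clique_1_1_large : (3 <= k)%N -> LEplus C X = 4 * K * (K + 1) / (K + 3).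
Proof.
move=> k_ge; rewrite LEplusE (@norm_natf _ _ (k - 3) (k + 3)); last first.
  by left; rewrite natrB // natrD -/K; field.
by rewrite natrB // natrD -/K; field.
Qed.
End CliqueAndTwoPoints.

(** * A clique and a single edge: n = 2k + 4 with n/2 odd *)

Section CliqueAndEdge.
Variables (C : numClosedFieldType) (X : sgraph) (k : nat).
Let K : C := k%:R.
Hypothesis Xs : disjoint_cliques X [:: k.+1; 2]%N.

Let K3 : K + 3 != 0. Proof. by rewrite -natrD pnatr_eq0 addn3. Qed.

Let dE : average_degree C X = ((K + 1) * K + 2) / (K + 3).
Proof.
rewrite (average_degree_disjoint_cliques C Xs) !big_cons big_nil /=.
by rewrite !(addn0, muln1) !(natrD, natrM) -natr1 -/K; congr (_ / _); ring.
Qed.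

Lemma Spec_clique_2 : perm_eq (Spec C X) (tally_seq [:: (-1, k.+1); (1, 1%N); (K, 1%N)]).
Proof.
apply: perm_trans (Spec_disjoint_cliques C Xs isT) _; apply/seq.permP => P.
by rewrite /= ?count_cat /= ?count_cat /= ?count_nseq; ring.
Qed.

Lemma LSpec_clique_2 :
  perm_eq (LSpec C X) (tally_seq [:: (0, 2%N); (2, 1%N); (K + 1, k)]).
Proof.
apply: perm_trans (LSpec_disjoint_cliques C Xs isT) _; apply/seq.permP => P.
by rewrite /= ?count_cat /= ?count_nseq -natr1 -/K /=; ring.
Qed.

Lemma QSpec_clique_2 :
  perm_eq (QSpec C X)
    (tally_seq [:: (2, 1%N); (0, 1%N); (2 * K, 1%N); (K - 1, k)]).
Proof.
apply: perm_trans (QSpec_disjoint_cliques C Xs isT) _; apply/seq.permP => P.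
have -> : K - 1 = k.+1%:R - 2 by rewrite -natr1 -/K; ring.
by rewrite /= ?count_cat /= ?count_nseq mulr1 subrr -/K /=; ring.
Qed.

Lemma energy_clique_2 : energy C X = 2 * K + 2.
Proof.
by rewrite (energy_disjoint_cliques C Xs isT) !big_cons big_nil /= mulr1 !addr0.
Qed.

(** Only the deviation of the eigenvalue 2 changes sign: K^2 - K - 4 is negative for k <= 2 and
    positive from k = 3 on. This makes n = 6 exceptional. *)
Let LEE : LE C X =
  2 * ((K + 1) * K + 2) / (K + 3) + (3 * K + 1) * K / (K + 3) +
  `|(K ^+ 2 - K - 4) / (K + 3)|.
Proof.
rewrite (LE_disjoint_cliques C Xs isT) !big_cons big_nil dE /= !addr0 mulr1n.
rewrite (@norm_natf _ (0 - _) ((k + 1) * k + 2) (k + 3)); last first.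
  by right; rewrite !(natrD, natrM) -/K; field.
rewrite (@norm_natf _ _ (3 * k + 1) (k + 3)); last first.
  by left; rewrite -natr1 !(natrM, natrD) -/K; field.
rewrite -mulr_natr !(natrM, natrD) -/K -[`|2 - _|]normrN.
rewrite (_ : - (2 - _) = (K ^+ 2 - K - 4) / (K + 3)); last by field.
by field.
Qed.

Lemma LE_clique_2_large : (3 <= k)%N -> LE C X = 2 * K * (3 * K + 1) / (K + 3).
Proof.
move=> k_ge; have le4 : (4 + k <= k * k)%N by nia.
rewrite LEE (@norm_natf _ _ (k * k - (4 + k)) (k + 3)); last first.
  by left; rewrite natrB // !(natrM, natrD) -/K; field.
by rewrite natrB // !(natrM, natrD) -/K; field.
Qed.

Lemma LE_clique_2_k1 : k = 1%N -> LE C X = 4.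
Proof.
move=> k1; rewrite LEE (@norm_natf _ _ 1 1).
  by rewrite /K k1; field.
by right; rewrite /K k1; field.
Qed.

(** The bound on k makes the deviation of 2K, with numerator K^2 + 5K - 2, positive. Two signs
    remain open: K - 5 is negative for k < 5 and K^2 - K - 4 for k < 3, which singles out k = 1 and
    k = 3, that is n = 6 and n = 10. *)
Let LEplusE : (1 <= k)%N -> LEplus C X =
  (K ^+ 2 + 5 * K - 2) / (K + 3) + `|(K - 5) / (K + 3)| * K +
  `|(K ^+ 2 - K - 4) / (K + 3)| + ((K + 1) * K + 2) / (K + 3).
Proof.
move=> k_gt0; have le2 : (2 <= k * k + 5 * k)%N by nia.
rewrite (LEplus_disjoint_cliques C Xs isT) !big_cons big_nil dE /= !addr0 mulr1n.
rewrite (@norm_natf _ _ (k * k + 5 * k - 2) (k + 3)); last first.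
  by left; rewrite natrB // !(natrM, natrD) -/K; field.
rewrite (@norm_natf _ (2 - 2 - _) ((k + 1) * k + 2) (k + 3)); last first.
  by right; rewrite !(natrD, natrM) -/K; field.
rewrite natrB // -mulr_natr !(natrM, natrD) -/K -[`|2 * 1 - _|]normrN.
rewrite (_ : k.+1%:R - 2 - _ = (K - 5) / (K + 3)); last first.
  by rewrite -natr1 -/K; field.
rewrite (_ : - (2 * 1 - _) = (K ^+ 2 - K - 4) / (K + 3)); last by field.
by field.
Qed.

Lemma LEplus_clique_2_large : (5 <= k)%N ->
  LEplus C X = 4 * (K + 1) * (K - 1) / (K + 3).
Proof.
move=> k_ge; have le4 : (4 + k <= k * k)%N by nia.
rewrite LEplusE; last by lia.
rewrite (@norm_natf _ _ (k - 5) (k + 3)); last first.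
  by left; rewrite natrB // natrD -/K; field.
rewrite (@norm_natf _ _ (k * k - (4 + k)) (k + 3)); last first.
  by left; rewrite natrB // !(natrM, natrD) -/K; field.
by rewrite !natrB // !(natrM, natrD) -/K; field.
Qed.

Lemma LEplus_clique_2_k1 : k = 1%N -> LEplus C X = 4.
Proof.
move=> k1; rewrite LEplusE ?k1 // (@norm_natf _ _ 1 1).
  rewrite (@norm_natf _ _ 1 1) /K ?k1; first by field.
  by right; field.
by right; rewrite /K k1; field.
Qed.

Lemma LEplus_clique_2_k3 : k = 3%N -> LEplus C X = 22 / 3.
Proof.
(* At k = 3 the two open quotients are -1/3 and 1/3. *)
move=> k3; rewrite LEplusE ?k3 // (@norm_natf _ _ 1 3).
  rewrite (@norm_natf _ _ 1 3) /K ?k3; first by field.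
  by left; field.
by right; rewrite /K k3; field.
Qed.
End CliqueAndEdge.

(** * Translation from k back to n *)

Theorem theorem3p1 (C : numClosedFieldType) (n : nat) (gT : finGroupType)
    (G : {group gT}) (hn : (3 <= n)%N)
    (hG : (G \isog Grp (x : y : x ^+ n = 1, y ^+ 2 = 1, y * x * y = x^-1))%g) :
  let N : C := n%:R in
  (* (1) *)
  ([/\ odd n ->
         perm_eq (Spec C (CCC G))
           (tally_seq [:: (-1, ((n - 3) %/ 2)%N); (0, 1%N); ((N - 3) / 2, 1%N)]),
       ~~ odd n -> ~~ odd (n %/ 2) ->
         perm_eq (Spec C (CCC G))
           (tally_seq [:: (-1, (n %/ 2 - 2)%N); (0, 2%N); (N / 2 - 2, 1%N)]) &
       ~~ odd n -> odd (n %/ 2) ->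
         perm_eq (Spec C (CCC G))
           (tally_seq [:: (-1, (n %/ 2 - 1)%N); (1, 1%N); (N / 2 - 2, 1%N)])]
   /\
   [/\ odd n -> energy C (CCC G) = N - 3,
       ~~ odd n -> ~~ odd (n %/ 2) -> energy C (CCC G) = N - 4 &
       ~~ odd n -> odd (n %/ 2) -> energy C (CCC G) = N - 2])
  /\
  (* (2) *)
  ([/\ odd n ->
         perm_eq (LSpec C (CCC G))
           (tally_seq [:: (0, 2%N); ((N - 1) / 2, ((n - 3) %/ 2)%N)]),
       ~~ odd n -> ~~ odd (n %/ 2) ->
         perm_eq (LSpec C (CCC G))
           (tally_seq [:: (0, 3%N); (N / 2 - 1, (n %/ 2 - 2)%N)]) &
       ~~ odd n -> odd (n %/ 2) ->
         perm_eq (LSpec C (CCC G))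
           (tally_seq [:: (0, 2%N); (2, 1%N); (N / 2 - 1, (n %/ 2 - 2)%N)])]
   /\
   [/\ odd n -> LE C (CCC G) = 2 * (N - 1) * (N - 3) / (N + 1),
       ~~ odd n -> ~~ odd (n %/ 2) ->
         LE C (CCC G) = 3 * (N - 2) * (N - 4) / (N + 2),
       n = 6%N -> LE C (CCC G) = 4 &
       ~~ odd n -> (10 <= n)%N -> odd (n %/ 2) ->
         LE C (CCC G) = (N - 4) * (3 * N - 10) / (N + 2)])
  /\
  (* (3) *)
  ([/\ odd n ->
         perm_eq (QSpec C (CCC G))
           (tally_seq [:: (0, 1%N); (N - 3, 1%N);
                          ((N - 5) / 2, ((n - 3) %/ 2)%N)]),
       ~~ odd n -> ~~ odd (n %/ 2) ->
         perm_eq (QSpec C (CCC G))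
           (tally_seq [:: (0, 2%N); (N - 4, 1%N);
                          (N / 2 - 3, (n %/ 2 - 2)%N)]) &
       ~~ odd n -> odd (n %/ 2) ->
         perm_eq (QSpec C (CCC G))
           (tally_seq [:: (2, 1%N); (0, 1%N); (N - 4, 1%N);
                          (N / 2 - 3, (n %/ 2 - 2)%N)])]
   /\
   (odd n -> LEplus C (CCC G) = (N - 3) * (N + 3) / (N + 1)) /\
   (n = 4%N \/ n = 8%N -> LEplus C (CCC G) = (N - 4) * (N + 6) / (N + 2)) /\
   (~~ odd n -> ~~ odd (n %/ 2) -> (12 <= n)%N ->
      LEplus C (CCC G) = 2 * (N - 2) * (N - 4) / (N + 2)) /\
   (n = 6%N -> LEplus C (CCC G) = 4) /\
   (n = 10%N -> LEplus C (CCC G) = 22 / 3) /\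
   (~~ odd n -> (14 <= n)%N -> odd (n %/ 2) ->
      LEplus C (CCC G) = 2 * (N - 2) * (N - 6) / (N + 2))).
Proof.
(* From here on only the clique decomposition of the graph is used. *)
move=> N; have := ccc_dihedral_cliques hn hG; move: (CCC G) => X XE.
have [odd_n|even_n] := boolP (odd n).
  have [k nE] : exists k, n = (2 * k + 3)%N by exists ((n - 3)./2); lia.
  have Xs : disjoint_cliques X [:: k.+1; 1]%N.
    by move: XE; rewrite odd_n (_ : n.-1./2 = k.+1) //; lia.
  have NE : N = 2 * k%:R + 3 by rewrite /N nE natrD natrM.
  have K2 : k%:R + 2 != 0 :> C by rewrite -natrD pnatr_eq0 addn2.
  have K4 : 2 * k%:R + 3 + 1 != 0 :> C.
    have -> : 2 * k%:R + 3 + 1 = (2 * k + 4)%:R :> C by rewrite natrD natrM; ring.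
    by rewrite pnatr_eq0 addnC.
  have kE : ((n - 3) %/ 2 = k)%N by lia.
  have -> : (N - 3) / 2 = k%:R by rewrite NE; field.
  have -> : (N - 1) / 2 = k%:R + 1 by rewrite NE; field.
  have -> : (N - 5) / 2 = k%:R - 1 by rewrite NE; field.
  have -> : N - 3 = 2 * k%:R by rewrite NE; ring.
  rewrite (energy_clique_1 C Xs) (LE_clique_1 C Xs) (LEplus_clique_1 C Xs) kE NE.
  (* The clauses for particular even n are vacuous when n is odd. *)
  have no (P : Prop) : n = 4%N \/ n = 8%N \/ n = 6%N \/ n = 10%N -> P by lia.
  split; [|split]; split.
  - by split=> // _; apply: Spec_clique_1.
  - by split.
  - by split=> // _; apply: LSpec_clique_1.
  - by split=> // [_|n6]; [field; rewrite K2 K4 | apply: no; lia].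
  - by split=> // _; apply: QSpec_clique_1.
  - split; first by move=> _; field; rewrite K2 K4.
    by do !split=> //; move=> ns; apply: no; lia.
(* For even n the rotation clique has order n/2 - 1 = k + 1. *)
have [k nE] : exists k, n = (2 * k + 4)%N by exists ((n - 4)./2); lia.
have NE : N = 2 * k%:R + 4 by rewrite /N nE natrD natrM.
have K3 : k%:R + 3 != 0 :> C by rewrite -natrD pnatr_eq0 addn3.
have K6 : 2 * k%:R + 4 + 2 != 0 :> C.
  have -> : 2 * k%:R + 4 + 2 = (2 * k + 6)%:R :> C by rewrite natrD natrM; ring.
  by rewrite pnatr_eq0 addnC.
have kE : (n %/ 2 - 2 = k)%N by lia.
have k1E : (n %/ 2 - 1 = k.+1)%N by lia.
have -> : N / 2 - 2 = k%:R by rewrite NE; field.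
have -> : N / 2 - 1 = k%:R + 1 by rewrite NE; field.
have -> : N / 2 - 3 = k%:R - 1 by rewrite NE; field.
have -> : N - 4 = 2 * k%:R by rewrite NE; ring.
rewrite kE k1E NE; have [odd_n2|even_n2] := boolP (odd (n %/ 2)); move: XE.
  rewrite (negPf even_n) -(divn2 n) odd_n2 (_ : n.-1./2 = k.+1) => [Xs|]; last by lia.
  rewrite (energy_clique_2 C Xs).
  split; [|split]; split.
  - by split=> // _ _; apply: Spec_clique_2.
  - by split=> // _ _; ring.
  - by split=> // _ _; apply: LSpec_clique_2.
  - split=> // [n6|_ n_ge _]; first by apply: (LE_clique_2_k1 C Xs); lia.
    by rewrite (LE_clique_2_large C Xs) ?NE; [field; rewrite K3 K6 | lia].
  - by split=> // _ _; apply: QSpec_clique_2.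
  (* With n/2 odd, n = 4 and n = 8 are excluded; n = 6, n = 10 and n >= 14 mean k = 1, k = 3 and k
     >= 5. *)
  - split=> //; split=> [|]; first by lia.
    split=> //; split=> [n6|]; first by apply: (LEplus_clique_2_k1 C Xs); lia.
    split=> [n10|_ n_ge _]; first by apply: (LEplus_clique_2_k3 C Xs); lia.
    by rewrite (LEplus_clique_2_large C Xs); [field; rewrite K3 K6 | lia].
rewrite (negPf even_n) -(divn2 n) (negPf even_n2) (_ : n.-1./2 = k.+1) => [Xs|]; last by lia.
rewrite (energy_clique_1_1 C Xs) (LE_clique_1_1 C Xs).
split; [|split]; split.
- by split=> // _ _; apply: Spec_clique_1_1.
- by split=> // _ _; ring.
- by split=> // _ _; apply: LSpec_clique_1_1.
- by split=> // [_ _|n6]; [field; rewrite K3 K6 | lia].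
- by split=> // _ _; apply: QSpec_clique_1_1.
(* Here n = 4 and n = 8 are k = 0 and k = 2, while n >= 12 gives k >= 4; the clauses for n = 6, n =
   10 contradict the parity of n/2. *)
- split=> //; split=> [n48|].
    by rewrite (LEplus_clique_1_1_small C Xs); [field; rewrite K3 K6 | lia].
  split=> [_ _ n_ge|].
    by rewrite (LEplus_clique_1_1_large C Xs); [field; rewrite K3 K6 | lia].
  by do !split=> //; lia.
Qed.
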